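(* Let $f:X\longrightarrow X$ be a continuous map acting on a metric space $(X,d)$. Then: (a) If there exists a LY, MLY, D1, D1$\tfrac12$, D2, D2$\tfrac12$ or D3 pair $(x,y)\in X\times X$ for $f$ and $d$, then there exists, respectively, a LY, MLY, D1, D1$\tfrac12$, D2, D2$\tfrac12$ or D3 pair $(K,L)\in\mathcal{K}(X)\times\mathcal{K}(X)$ for $\overline{f}$ and $d_H$ such that $K\subset L$. In particular, such a pair $(K,L)$ can be chosen fulfilling that $$d_H(\overline{f}^j(K),\overline{f}^j(L))=d(f^j(x),f^j(y))\quad\text{for all } j\in\mathbb{N}_0.$$ (b) If there exists a LY, MLY, D1, D1$\tfrac12$, D2, D2$\tfrac12$ or D3 pair $(K,L)$ for $\overline{f}$ and $d_H$ with $K\subset L$, then $(\mathcal{F}_\infty(X),\hat{f})$ is U-LYC, U-MLYC, U-DC1, U-DC1$\tfrac12$, U-DC2, U-DC2$\tfrac12$ or U-DC3, respectively. (c) If there exists a LY, D1, D1$\tfrac12$, D2 or D2$\tfrac12$ pair $(K,L)$ for $\overline{f}$ and $d_H$ with $K\subset L$, then $(\mathcal{F}_0(X),\hat{f})$, $(\mathcal{F}_S(X),\hat{f})$ and $(\mathcal{F}_E(X),\hat{f})$ are LYC, DC1, DC1$\tfrac12$, DC2 or DC2$\tfrac12$, respectively. (d) If there exists a MLY pair $(K,L)$ for $\overline{f}$ and $d_H$ with $K\subset L$, and if the set $\{d_H(\overline{f}^j(K),\overline{f}^j(L)): j\in\mathbb{N}\}$ is bounded, then the systems $(\mathcal{F}_0(X),\hat{f})$,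 $(\mathcal{F}_S(X),\hat{f})$ and $(\mathcal{F}_E(X),\hat{f})$ are MLYC.
   Context: Notation: $\mathbb{N}=\{1,2,3,\dots\}$, $\mathbb{N}_0=\mathbb{N}\cup\{0\}$, $\mathbb{I}=[0,1]$. **Chaos notions.** For $A\subset\mathbb{N}$, $\underline{\operatorname{dens}}(A):=\liminf_{n\to\infty}\frac{\#(A\cap[1,n])}{n}$ and $\overline{\operatorname{dens}}(A):=\limsup_{n\to\infty}\frac{\#(A\cap[1,n])}{n}$. Let $g:Y\to Y$ be a continuous map on a metric space $(Y,\rho)$, and let $(x,y)\in Y\times Y$. For $\delta>0$ put $\Phi_{(x,y)}(\delta):=\underline{\operatorname{dens}}(\{j\in\mathbb{N}: \rho(g^j(x),g^j(y))<\delta\})$ and $\Phi^*_{(x,y)}(\delta):=\overline{\operatorname{dens}}(\{j\in\mathbb{N}: \rho(g^j(x),g^j(y))<\delta\})$. For $g$ and $\rho$, the pair $(x,y)$ is: - a LY $\varepsilon$-pair ($\varepsilon>0$) if $\limsup_{n}\rho(g^n(x),g^n(y))\geq\varepsilon$ and $\liminf_{n}\rho(g^n(x),g^n(y))=0$; - a MLY $\varepsilon$-pair ($\varepsilon>0$) if $\limsup_n\frac1n\sum_{j=1}^n\rho(g^j(x),g^j(y))\geq\varepsilon$ and $\liminf_n\frac1n\sum_{j=1}^n\rho(g^j(x),g^j(y))=0$; - a D1 $\varepsilon$-pair ($\varepsilon>0$) if $\Phi_{(x,y)}(\varepsilon)=0$ and $\Phi^*_{(x,y)}(\delta)=1$ for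 all $\delta>0$; - a D1$\tfrac12$ pair if $\lim_{\delta\to0^+}\Phi_{(x,y)}(\delta)=0$ and $\Phi^*_{(x,y)}(\delta)=1$ for all $\delta>0$; - a D2 $\varepsilon$-pair ($0<\varepsilon\leq1$) if $\Phi_{(x,y)}(\varepsilon)\leq1-\varepsilon$ and $\Phi^*_{(x,y)}(\delta)=1$ for all $\delta>0$; - a D2$\tfrac12$ $(\varepsilon,c)$-pair ($\varepsilon,c>0$) if $\Phi_{(x,y)}(\delta)<c<\Phi^*_{(x,y)}(\delta)$ whenever $0<\delta\leq\varepsilon$; - a D3 $(a,b)$-pair ($0\leq a<b$) if $\Phi_{(x,y)}(\delta)<\Phi^*_{(x,y)}(\delta)$ whenever $a<\delta<b$. A LY (MLY, D1, D2, D2$\tfrac12$, D3) pair is a pair that is such a pair for some value of the parameter(s). For $P\in\{$LY, MLY, D1, D1$\tfrac12$, D2, D2$\tfrac12$, D3$\}$, a set $S\subset Y$ is $P$ scrambled if every pair $(x,y)$ of distinct points of $S$ is a $P$ pair; it is $P$ $\varepsilon$-scrambled (for LY, MLY, D1, D2; with $0<\varepsilon\le 1$ for D2), D2$\tfrac12$ $(\varepsilon,c)$-scrambled, or D3 $(a,b)$-scrambled if every pair of distinct points of $S$ is a $P$ pair with those same parameters. $S$ is D1$\tfrac12$ U-scrambled if it is D1$\tfrac12$ scrambled and $\lim_{\delta\to0^+}\sup\{\Phi_{(x,y)}(\delta): x,y\in S,\ x\neq y\}=0$. The system $(Y,g)$ is LYC, MLYC, DC1, DC1$\tfrac12$, DC2,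 DC2$\tfrac12$, DC3 (for $\rho$) if there is an uncountable $S\subset Y$ that is, respectively, LY, MLY, D1, D1$\tfrac12$, D2, D2$\tfrac12$, D3 scrambled. It is U-LYC, U-MLYC, U-DC1, U-DC2 if there is an uncountable $S$ that is, respectively, LY, MLY, D1, D2 $\varepsilon$-scrambled for some $\varepsilon>0$; U-DC1$\tfrac12$ if there is an uncountable D1$\tfrac12$ U-scrambled set; U-DC2$\tfrac12$ if there is an uncountable D2$\tfrac12$ $(\varepsilon,c)$-scrambled set for some $\varepsilon,c>0$; U-DC3 if there is an uncountable D3 $(a,b)$-scrambled set for some $0\leq a<b$. **Hyperspaces.** $\mathcal{K}(X)$ is the set of non-empty compact subsets of $X$. For non-empty closed sets $C_1,C_2$, $d_H(C_1,C_2):=\max\{\sup_{x_1\in C_1}\inf_{x_2\in C_2}d(x_1,x_2),\ \sup_{x_2\in C_2}\inf_{x_1\in C_1}d(x_2,x_1)\}$ (Hausdorff metric on $\mathcal{K}(X)$). $\overline{f}:\mathcal{K}(X)\to\mathcal{K}(X)$ is $\overline{f}(K):=f(K)$. **Fuzzy sets.** $\mathcal{F}(X)$ is the set of upper-semicontinuous functions $u:X\to\mathbb{I}$ such that $u_0:=\overline{\{x: u(x)>0\}}$ is compact and $u_1\neq\varnothing$, where $u_\alpha:=\{x: u(x)\geq\alpha\}$ for $\alpha\in\,]0,1]$. The Zadeh extension $\hat{f}:\mathcal{F}(X)\to\mathcal{F}(X)$ is $[\hat{f}(u)](x):=\sup\{u(y): y\in f^{-1}(\{x\})\}$ if $f^{-1}(\{x\})\neq\varnothing$,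 and $0$ otherwise (it is well defined and continuous for all metrics below). Metrics on $\mathcal{F}(X)$: - $d_\infty(u,v):=\sup_{\alpha\in\mathbb{I}}d_H(u_\alpha,v_\alpha)$; - $d_0(u,v):=\inf\{\varepsilon>0:$ there is a strictly increasing homeomorphism $\xi:\mathbb{I}\to\mathbb{I}$ with $\sup_{\alpha\in\mathbb{I}}|\xi(\alpha)-\alpha|\leq\varepsilon$ and $d_\infty(u,\xi\circ v)\leq\varepsilon\}$; - on $X\times\mathbb{I}$ let $\overline{d}((x,\alpha),(y,\beta)):=\max\{d(x,y),|\alpha-\beta|\}$, and let $\operatorname{end}(u):=\{(x,\alpha)\in X\times\mathbb{I}: u(x)\geq\alpha\}$, $\operatorname{send}(u):=\operatorname{end}(u)\cap(u_0\times\mathbb{I})$. Then $d_S(u,v)$ is the Hausdorff distance (induced by $\overline{d}$) between $\operatorname{send}(u)$ and $\operatorname{send}(v)$, and $d_E(u,v)$ is the Hausdorff distance (induced by $\overline{d}$) between $\operatorname{end}(u)$ and $\operatorname{end}(v)$. $\mathcal{F}_\infty(X),\mathcal{F}_0(X),\mathcal{F}_S(X),\mathcal{F}_E(X)$ denote $\mathcal{F}(X)$ with the metric $d_\infty,d_0,d_S,d_E$ respectively. *)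

(* Defs.v *)
From HB Require Import structures.
From mathcomp Require Import all_boot all_order all_algebra.
From mathcomp Require Import all_classical all_reals all_analysis.

Set Implicit Arguments.
Unset Strict Implicit.
Unset Printing Implicit Defensive.

Import Order.TTheory GRing.Theory Num.Theory.
Import numFieldNormedType.Exports.

Local Open Scope classical_set_scope.
Local Open Scope ring_scope.

(* All upper and lower limits are taken in [\bar R], so that they exist also
   for unbounded sequences of distances. *)
Section density.
Context (R : realType).
Implicit Type A : set nat.

Definition frequency A (n : nat) : R :=
  (\sum_(1 <= j < n.+1) (j \in A))%N%:R / n%:R.

Definition lower_density A : \bar R := limn_einf (EFin \o frequency A).

Definition upper_density A : \bar R := limn_esup (EFin \o frequency A).

End density.

Inductive chaos_kind := LY | MLY | D1 | D1half | D2 | D2half | D3.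

Section chaos.
Context (R : realType) (Y : Type) (rho : Y -> Y -> R) (g : Y -> Y).
Implicit Types (x y : Y) (eps delta a b c : R) (S : set Y).

Definition orbit_dist x y (j : nat) : R := rho (iter j g x) (iter j g y).

Definition mean_orbit_dist x y (n : nat) : R :=
  (\sum_(1 <= j < n.+1) orbit_dist x y j) / n%:R.

Definition Phi x y delta : \bar R :=
  lower_density R [set j : nat | orbit_dist x y j < delta].

Definition Phi_star x y delta : \bar R :=
  upper_density R [set j : nat | orbit_dist x y j < delta].

Definition LY_pair eps x y : Prop :=
  (eps%:E <= limn_esup (EFin \o orbit_dist x y))%E /\
  limn_einf (EFin \o orbit_dist x y) = 0%E.

Definition MLY_pair eps x y : Prop :=
  (eps%:E <= limn_esup (EFin \o mean_orbit_dist x y))%E /\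
  limn_einf (EFin \o mean_orbit_dist x y) = 0%E.

Definition D1_pair eps x y : Prop :=
  Phi x y eps = 0%E /\ forall delta, 0 < delta -> Phi_star x y delta = 1%E.

Definition D1half_pair x y : Prop :=
  Phi x y delta @[delta --> (0 : R)^'+] --> 0%E /\
  forall delta, 0 < delta -> Phi_star x y delta = 1%E.

Definition D2_pair eps x y : Prop :=
  (Phi x y eps <= (1 - eps)%:E)%E /\
  forall delta, 0 < delta -> Phi_star x y delta = 1%E.

Definition D2half_pair eps c x y : Prop :=
  forall delta, 0 < delta <= eps ->
    (Phi x y delta < c%:E)%E /\ (c%:E < Phi_star x y delta)%E.

Definition D3_pair a b x y : Prop :=
  forall delta, a < delta < b -> (Phi x y delta < Phi_star x y delta)%E.

Definition chaos_pair (P : chaos_kind) x y : Prop :=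
  match P with
  | LY => exists2 eps, 0 < eps & LY_pair eps x y
  | MLY => exists2 eps, 0 < eps & MLY_pair eps x y
  | D1 => exists2 eps, 0 < eps & D1_pair eps x y
  | D1half => D1half_pair x y
  | D2 => exists2 eps, 0 < eps <= 1 & D2_pair eps x y
  | D2half => exists eps c, [/\ 0 < eps, 0 < c & D2half_pair eps c x y]
  | D3 => exists a b, [/\ 0 <= a, a < b & D3_pair a b x y]
  end.

Definition scrambled (Q : Y -> Y -> Prop) S : Prop :=
  forall x y, S x -> S y -> x <> y -> Q x y.

Definition D1half_U_scrambled S : Prop :=
  scrambled D1half_pair S /\
  ereal_sup [set z | exists x y, [/\ S x, S y, x <> y & z = Phi x y delta]]
    @[delta --> (0 : R)^'+] --> 0%E.

(* LYC, MLYC, DC1, DC1half, DC2, DC2half, DC3 *)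
Definition chaotic (P : chaos_kind) : Prop :=
  exists2 S, ~ countable S & scrambled (chaos_pair P) S.

(* U-LYC, U-MLYC, U-DC1, U-DC1half, U-DC2, U-DC2half, U-DC3 *)
Definition U_chaotic (P : chaos_kind) : Prop :=
  exists2 S, ~ countable S &
  match P with
  | LY => exists2 eps, 0 < eps & scrambled (LY_pair eps) S
  | MLY => exists2 eps, 0 < eps & scrambled (MLY_pair eps) S
  | D1 => exists2 eps, 0 < eps & scrambled (D1_pair eps) S
  | D1half => D1half_U_scrambled S
  | D2 => exists2 eps, 0 < eps <= 1 & scrambled (D2_pair eps) S
  | D2half => exists eps c,
      [/\ 0 < eps, 0 < c & scrambled (D2half_pair eps c) S]
  | D3 => exists a b, [/\ 0 <= a, a < b & scrambled (D3_pair a b) S]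
  end.

End chaos.

(* The real-valued [sup] is [0] on sets that are empty or unbounded; below,
   the distance is only applied to pairs of non-empty sets for which the two
   suprema are finite. *)
Definition hausdorff_dist (R : realType) (T : Type) (rho : T -> T -> R)
    (A B : set T) : R :=
  Num.max (sup [set inf [set rho x y | y in B] | x in A])
          (sup [set inf [set rho y x | x in A] | y in B]).

Section hyperspace.
Context (R : realType) (X : metricType R).

Record hyperspace := Hyperspace {
  hyper_set :> set X;
  hyper_nonempty : hyper_set !=set0;
  hyper_compact : compact hyper_set }.

Definition dH (K L : hyperspace) : R := hausdorff_dist (@mdist R X) K L.

Context (f : X -> X) (cf : continuous f).

Lemma hyper_map_nonempty (K : hyperspace) : f @` K !=set0.
Proof. by have [x Kx] := hyper_nonempty K; exists (f x); exists x. Qed.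

Lemma hyper_map_compact (K : hyperspace) : compact (f @` K).
Proof.
by apply: continuous_compact; [exact: continuous_subspaceT|exact: hyper_compact].
Qed.

Definition hyper_map (K : hyperspace) : hyperspace :=
  Hyperspace (hyper_map_nonempty K) (@hyper_map_compact K).

End hyperspace.

Section level_sets.
Context (R : realType) (X : metricType R).
Implicit Types u v : X -> R.

Definition fuzzy_support u : set X := closure [set x | 0 < u x].

Definition level u (alpha : R) : set X :=
  if alpha == 0 then fuzzy_support u else [set x | alpha <= u x].

Definition upper_semicontinuous u : Prop :=
  forall x a, u x < a -> \forall y \near x, u y < a.

Definition d_infty u v : R :=
  sup [set hausdorff_dist (@mdist R X) (level u alpha) (level v alpha)
      | alpha in `[0, 1]].

Definition increasing_homeo (xi : R -> R) : Prop :=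
  {in `[0, 1] &, {homo xi : s t / s < t}} /\
  exists zeta : R -> R,
    [/\ set_fun `[0, 1] `[0, 1] xi /\ set_fun `[0, 1] `[0, 1] zeta,
        {in `[0, 1], cancel xi zeta} /\ {in `[0, 1], cancel zeta xi},
        {within `[0, 1], continuous xi} & {within `[0, 1], continuous zeta}].

Definition d_zero u v : R :=
  inf [set eps : R | 0 < eps /\
    exists xi : R -> R, [/\ increasing_homeo xi,
      sup [set `|xi alpha - alpha| | alpha in `[0, 1]] <= eps &
      d_infty u (xi \o v) <= eps]].

Definition dbar (p q : X * R) : R :=
  Num.max (mdist p.1 q.1) `|p.2 - q.2|.

Definition endograph u : set (X * R) :=
  [set p | 0 <= p.2 <= 1 /\ p.2 <= u p.1].

Definition sendograph u : set (X * R) :=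
  endograph u `&` (fuzzy_support u `*` `[0, 1]).

Definition d_send u v : R := hausdorff_dist dbar (sendograph u) (sendograph v).

Definition d_end u v : R := hausdorff_dist dbar (endograph u) (endograph v).

End level_sets.

Section fuzzy.
Context (R : realType) (X : metricType R).

Record fuzzy := Fuzzy {
  fuzzy_fun :> X -> R;
  fuzzy_itv : forall x, 0 <= fuzzy_fun x <= 1;
  fuzzy_usc : upper_semicontinuous fuzzy_fun;
  fuzzy_compact : compact (level fuzzy_fun 0);
  fuzzy_normal : level fuzzy_fun 1 !=set0 }.

Definition zadeh_fun (f : X -> X) (u : X -> R) (x : X) : R :=
  if `[< f @^-1` [set x] !=set0 >] then sup [set u y | y in f @^-1` [set x]]
  else 0.

Context (f : X -> X) (cf : continuous f) (u : fuzzy).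

Let u_ub x : ubound [set u y | y in f @^-1` [set x]] 1.
Proof. by move=> _ [y _ <-]; have /andP[] := fuzzy_itv u y. Qed.

Let zadeh_ge y : u y <= zadeh_fun f u (f y).
Proof.
rewrite /zadeh_fun asboolT; last by exists y.
by apply: ub_le_sup; [exists 1; exact: u_ub|exists y].
Qed.

Let zadeh_le x b : 0 <= b -> (forall y, f y = x -> u y <= b) ->
  zadeh_fun f u x <= b.
Proof.
move=> b0 ub; rewrite /zadeh_fun; case: asboolP => // -[y fyx].
by apply: ge_sup; [exists (u y), y|move=> _ [z fzx <-]; exact: ub].
Qed.

Lemma zadeh_itv x : 0 <= zadeh_fun f u x <= 1.
Proof.
apply/andP; split; last first.
  by apply: zadeh_le => // y _; have /andP[] := fuzzy_itv u y.
rewrite {1}/zadeh_fun; case: asboolP => // -[y fyx].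
have /andP[uy0 _] := fuzzy_itv u y.
apply: (le_trans uy0); apply: ub_le_sup; first by exists 1; exact: u_ub.
by exists y.
Qed.

Lemma zadeh_usc : upper_semicontinuous (zadeh_fun f u).
Proof.
move=> x a xa.
have [b /andP[xb ba]] : exists b, zadeh_fun f u x < b < a.
  by exists ((zadeh_fun f u x + a) / 2); rewrite !midf_lt.
have b0 : 0 < b by apply: le_lt_trans xb; have /andP[] := zadeh_itv x.
have cl : closed [set y | b <= u y].
  rewrite -[X in closed X]setCK; apply: open_closedC.
  rewrite openE => y /= /negP; rewrite -ltNge => /fuzzy_usc.
  by apply: filterS => z zb; apply/negP; rewrite -ltNge.
have co : compact [set y | b <= u y].
  apply: (subclosed_compact cl (fuzzy_compact (f:=u))).
  rewrite /level eqxx => y /= by_; apply: subset_closure => /=.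
  exact: lt_le_trans by_.
have cof : closed (f @` [set y | b <= u y]).
  apply: compact_closed; first exact: metric_hausdorff.
  by apply: continuous_compact co; exact: continuous_subspaceT.
have : nbhs x (~` (f @` [set y | b <= u y])).
  apply: open_nbhs_nbhs; split; first exact: closed_openC.
  by move=> [y /= bu fyx]; move: (zadeh_ge y); rewrite fyx leNgt (lt_le_trans xb).
apply: filterS => z zN; apply: le_lt_trans ba; apply: zadeh_le; first exact: ltW.
by move=> y fyz; rewrite leNgt; apply/negP => /ltW bu; apply: zN; exists y.
Qed.

Lemma zadeh_compact : compact (level (zadeh_fun f u) 0).
Proof.
have co : compact (f @` level u 0).
  by apply: continuous_compact; [exact: continuous_subspaceT|exact: fuzzy_compact].
have cl : closed (f @` level u 0).
  by apply: compact_closed => //; exact: metric_hausdorff.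
rewrite {1}/level eqxx; apply: (subclosed_compact _ co).
  exact: closed_closure.
rewrite [X in _ `<=` X](closure_id _).1//; apply: closureS => x /= x0.
apply: contrapT => xN; move: x0; rewrite ltNge => /negP; apply.
apply: zadeh_le => // y fyx; rewrite leNgt; apply/negP => uy; apply: xN.
by exists y => //; rewrite /level eqxx; exact: subset_closure.
Qed.

Lemma zadeh_normal : level (zadeh_fun f u) 1 !=set0.
Proof.
have [y] := fuzzy_normal u; rewrite /level oner_eq0 /= => u1.
by exists (f y) => /=; exact: le_trans (zadeh_ge y).
Qed.

Definition zadeh : fuzzy :=
  Fuzzy zadeh_itv zadeh_usc zadeh_compact zadeh_normal.

End fuzzy.

Section fuzzy_metrics.
Context (R : realType) (X : metricType R).

Definition dF_infty (u v : fuzzy X) : R := d_infty u v.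
Definition dF_zero (u v : fuzzy X) : R := d_zero u v.
Definition dF_send (u v : fuzzy X) : R := d_send u v.
Definition dF_end (u v : fuzzy X) : R := d_end u v.

End fuzzy_metrics.

(* Main.v *)
Require Import Defs.
From mathcomp Require Import all_boot all_order all_algebra.
From mathcomp Require Import all_classical all_reals all_analysis.
From mathcomp Require Import ring lra.

Set Implicit Arguments.
Unset Strict Implicit.
Unset Printing Implicit Defensive.

Import Order.TTheory GRing.Theory Num.Theory.
Import numFieldNormedType.Exports.

Local Open Scope classical_set_scope.
Local Open Scope ring_scope.

(** Any two points x, y give compact sets [set x] and [set x; y] whose images
    under iteration stay at Hausdorff distance d(f^j x, f^j y); since every
    chaos notion depends only on the sequence of orbit distances, a pair for
    f yields a nested pair for the hyperspace map.

    For a nested pair K `<=` L, consider for 0 < s < 1 the fuzzy set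
    [step K L s] with value 1 on K, s on the rest of L and 0 elsewhere.  Its
    only level sets are L (up to height s) and K (above s), and the Zadeh
    extension sends [step K L s] to [step (f @` K) (f @` L) s]
    ([zadeh_fun_step]): the parameter s is preserved along the orbit.  Hence the orbit distances of
    [step K L s] and [step K L t] are explicit in D_j, the Hausdorff distance of
    the j-th images of K and L:
    - for d_infty they are D_j, because the two fuzzy sets have levels L and K
      at every height between s and t ([d_infty_step]);
    - for d_0, d_S and d_E they are min(|s - t|, D_j): one may either move the
      plateau from height t to height s, or move the points of L to K
      ([d_zero_step], [d_send_step], [d_end_step]).

    In the first case all pairs of the uncountable family (step K L s)_s have
    the orbit distances of (K, L), so the family is scrambled uniformly
    ([U_chaotic_of_equal_orbits]).  In the second case truncation at the
    positive level |s - t| leaves the sets {j | D_j < delta} unchanged for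
    delta <= |s - t|, so every notion other than MLY and D3 survives, with
    constants depending on the pair ([truncated_chaos_pair]).  For MLY pairs a
    bound M >= e := |s - t| on the D_j gives
    min(e, D_j) >= (e / M) D_j, and the upper mean stays positive
    ([truncated_MLY_pair]).  The members are distinct for distinct s since a
    chaos pair has K <> L ([orbit_dist0_not_chaos_pair]). *)

(** * Upper and lower limits and densities *)

Section limits.
Context (R : realType).
Implicit Types (u v : nat -> R) (a : R).

(** The useful form of a lower bound on an upper limit: being frequently
    above every smaller value transfers between sequences that are compared
    termwise, also after truncation or rescaling. *)
Lemma limn_esup_geP u a : (a%:E <= limn_esup (EFin \o u))%E <->
  forall r, r < a -> forall N, exists2 n, (N <= n)%N & r < u n.
Proof.
split=> [au r ra N|H].
  apply: contrapT => Hn; move: au; apply/negP; rewrite -ltNge.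
  apply: (@le_lt_trans _ _ r%:E); last by rewrite lte_fin.
  pose tail := [set n | (N <= n)%N].
  apply: (@le_trans _ _ (ereal_sup [set (EFin \o u) n | n in tail])).
    by apply: ereal_inf_lbound; exists tail => //; exists N.
  apply/ereal_supP => _ [n /= Nn <-]; rewrite lee_fin leNgt.
  by apply/negP => run; apply: Hn; exists n.
apply/ereal_infP => _ [V [N _ NV] <-].
apply/lee_subgt0Pr => e e0.
have [n Nn un] := H (a - e) ltac:(by rewrite ltrBlDr ltrDl) N.
apply: (@le_trans _ _ (u n)%:E); first by rewrite -EFinB lee_fin ltW.
by apply: ereal_sup_ubound; exists n => //; exact: NV.
Qed.

Lemma le_limn_esup (u v : nat -> \bar R) : (forall n, u n <= v n)%E ->
  (limn_esup u <= limn_esup v)%E.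
Proof.
move=> uv; apply/ereal_infP => _ [V FV <-].
apply: (@le_trans _ _ (ereal_sup [set u n | n in V])).
  by apply: ereal_inf_lbound; exists V.
apply/ereal_supP => _ [n Vn <-]; apply: (le_trans (uv n)).
by apply: ereal_sup_ubound; exists n.
Qed.

Lemma le_limn_einf (u v : nat -> \bar R) : (forall n, u n <= v n)%E ->
  (limn_einf u <= limn_einf v)%E.
Proof.
by move=> uv; rewrite /limn_einf leeN2 le_limn_esup// => n; rewrite leeN2.
Qed.

Lemma limn_einf_squeeze0 u v : (forall n, 0 <= v n <= u n) ->
  limn_einf (EFin \o u) = 0%E -> limn_einf (EFin \o v) = 0%E.
Proof.
move=> vu u0; apply/eqP; rewrite eq_le; apply/andP; split.
  by rewrite -u0; apply: le_limn_einf => n; rewrite lee_fin; case/andP: (vu n).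
rewrite -[leLHS](@cvg_limn_einf_sup R (cst 0%E) 0%E (cvg_cst _)).1.
by apply: le_limn_einf => n; rewrite lee_fin; case/andP: (vu n).
Qed.

End limits.

Section density_lemmas.
Context (R : realType).
Implicit Types A B : set nat.

Lemma le_frequency A B n : A `<=` B -> frequency R A n <= frequency R B n.
Proof.
move=> AB; rewrite /frequency ler_wpM2r ?invr_ge0// ler_nat leq_sum// => j _.
by have [/set_mem/AB/mem_set ->|] := boolP (j \in A).
Qed.

Lemma frequency_setT n : frequency R setT n = (n != 0%N)%:R.
Proof.
rewrite /frequency; under eq_bigr do rewrite in_setT.
rewrite sum_nat_const_nat muln1 subn1 /=.
by case: n => [|n]; rewrite ?mul0r// divff// pnatr_eq0.
Qed.

Lemma frequency_set0 n : frequency R set0 n = 0.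
Proof.
by rewrite /frequency; under eq_bigr do rewrite in_set0; rewrite big1// mul0r.
Qed.

Lemma frequency_setT_cvg : (EFin \o frequency R setT) @ \oo --> 1%E.
Proof.
apply: cvg_near_cst; exists 1%N => // n /= n0.
by rewrite frequency_setT -lt0n n0.
Qed.

Lemma le_lower_density A B : A `<=` B ->
  (lower_density R A <= lower_density R B)%E.
Proof.
by move=> AB; apply: le_limn_einf => n; rewrite lee_fin le_frequency.
Qed.

Lemma le_upper_density A B : A `<=` B ->
  (upper_density R A <= upper_density R B)%E.
Proof.
by move=> AB; apply: le_limn_esup => n; rewrite lee_fin le_frequency.
Qed.

Lemma lower_density_setT : lower_density R setT = 1%E.
Proof. by rewrite /lower_density (cvg_limn_einf_sup frequency_setT_cvg).1. Qed.

Lemma upper_density_setT : upper_density R setT = 1%E.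
Proof. by rewrite /upper_density (cvg_limn_einf_sup frequency_setT_cvg).2. Qed.

Lemma lower_density_ge0 A : (0 <= lower_density R A)%E.
Proof.
rewrite -[leLHS](@cvg_limn_einf_sup R (cst 0%E) 0%E (cvg_cst _)).1.
by apply: le_limn_einf => n; rewrite lee_fin -(frequency_set0 n) le_frequency.
Qed.

Lemma upper_density_le1 A : (upper_density R A <= 1)%E.
Proof. by rewrite -upper_density_setT; exact: le_upper_density. Qed.

End density_lemmas.

(** * Chaos notions read off the orbit distances *)

Section transfer.
Context (R : realType) (Y Z : Type).
Context (rho : Y -> Y -> R) (g : Y -> Y) (x y : Y).
Context (sigma : Z -> Z -> R) (h : Z -> Z).
Local Notation D := (orbit_dist rho g x y).

Lemma eq_orbit_chaos_pair P z w : orbit_dist sigma h z w =1 D ->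
  chaos_pair rho g P x y -> chaos_pair sigma h P z w.
Proof.
move/funext => E; case: P; rewrite /chaos_pair /LY_pair /MLY_pair /D1_pair
  /D1half_pair /D2_pair /D2half_pair /D3_pair /Phi /Phi_star
  /mean_orbit_dist E//.
Qed.

(** Equal orbit distances give all pairs of S the same constants, so no
    uniformity is lost.  In the D1half case the supremum over S is that of
    a singleton, provided S has two distinct points. *)
Lemma U_chaotic_of_equal_orbits P (S : set Z) :
  ~ countable S ->
  (forall z w, S z -> S w -> z <> w -> orbit_dist sigma h z w =1 D) ->
  chaos_pair rho g P x y -> U_chaotic sigma h P.
Proof.
move=> Su SD.
have {}SD z w : S z -> S w -> z <> w -> orbit_dist sigma h z w = D.
  by move=> *; apply/funext; exact: SD.
have PhiE z w : S z -> S w -> z <> w -> Phi sigma h z w = Phi rho g x y.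
  by move=> Sz Sw zw; rewrite /Phi SD.
case: P => /= xy; exists S => //.
- case: xy => eps e0 xy; exists eps => // z w Sz Sw zw.
  by rewrite /LY_pair SD.
- case: xy => eps e0 xy; exists eps => // z w Sz Sw zw.
  by rewrite /MLY_pair /mean_orbit_dist SD.
- case: xy => eps e0 xy; exists eps => // z w Sz Sw zw.
  by rewrite /D1_pair /Phi_star PhiE// SD.
- split.
    by move=> z w Sz Sw zw; rewrite /= /D1half_pair /Phi_star PhiE// SD.
  have [z [w [Sz Sw zw]]] : exists z w, [/\ S z, S w & z <> w].
    apply: contrapT => Sn; apply: Su; have [->|/set0P[z Sz]] := eqVneq S set0.
      exact: countable0.
    suff -> : S = [set z] by exact/finite_set_countable/finite_set1.
    apply/seteqP; split=> [w Sw|_ ->//]; apply: contrapT => wz.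
    by apply: Sn; exists w, z.
  case: xy => P0 _; apply: cvg_trans P0; apply: near_eq_cvg.
  apply: nearW => delta.
  rewrite [X in ereal_sup X](_ : _ = [set Phi rho g x y delta]).
    by rewrite ereal_sup1.
  apply/seteqP; split=> [_ [u [v [Su' Sv uv ->]]]|_ ->].
    by rewrite /= PhiE.
  by exists z, w; rewrite PhiE.
- case: xy => eps e0 xy; exists eps => // z w Sz Sw zw.
  by rewrite /D2_pair /Phi_star PhiE// SD.
- case: xy => eps [c [e0 c0 xy]]; exists eps, c; split => // z w Sz Sw zw.
  by rewrite /D2half_pair /Phi_star PhiE// SD.
- case: xy => a [b [a0 ab xy]]; exists a, b; split => // z w Sz Sw zw.
  by rewrite /D3_pair /Phi_star PhiE// SD.
Qed.

(** If the orbits coincide, every density Phi and Phi_star at a positive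
    distance is 1 and every mean vanishes, which contradicts the separation
    clause of each notion. *)
Lemma orbit_dist0_not_chaos_pair P : D =1 (fun=> 0) -> ~ chaos_pair rho g P x y.
Proof.
move=> D0; have DE : D = (fun=> 0) by apply/funext.
have dens1 delta : 0 < delta ->
    Phi rho g x y delta = 1%E /\ Phi_star rho g x y delta = 1%E.
  move=> d0; rewrite /Phi /Phi_star.
  have -> : [set j | D j < delta] = setT.
    by apply/seteqP; split => // j _ /=; rewrite D0.
  by rewrite lower_density_setT upper_density_setT.
have sup0 : limn_esup (EFin \o (fun=> 0) : nat -> \bar R) = 0%E.
  exact: (cvg_limn_einf_sup (cvg_cst _)).2.
case: P => /=.
- case=> eps e0 []; rewrite DE sup0 lee_fin leNgt e0//.
- case=> eps e0 [].
  have -> : mean_orbit_dist rho g x y = fun=> 0.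
    by apply/funext => n; rewrite /mean_orbit_dist big1 ?mul0r.
  by rewrite sup0 lee_fin leNgt e0.
- case=> eps e0 [+ _]; rewrite (dens1 _ e0).1 => /eqP.
  by rewrite eqe oner_eq0.
- case=> + _ => P0.
  have P1 : Phi rho g x y delta @[delta --> 0^'+] --> 1%E.
    apply: cvg_near_cst; near=> d; apply: (dens1 _ _).1.
    by near: d; exact: nbhs_right_gt.
  have P01 : 0%E = 1%E :> \bar R
    by exact: (cvg_unique (@ereal_hausdorff R) P0 P1).
  move/eqP: P01.
  by rewrite eqe eq_sym oner_eq0.
- case=> eps /andP[e0 _] [+ _]; rewrite (dens1 _ e0).1 lee_fin.
  by rewrite lerBrDl addrC -lerBrDl subrr leNgt e0.
- case=> eps [c [e0 c0 /(_ eps)]]; rewrite e0 lexx => /(_ isT) [].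
  have [-> ->] := dens1 _ e0.
  by move=> c1; rewrite ltNge (ltW c1).
- case=> a [b [a0 ab /(_ ((a + b) / 2))]]; rewrite !midf_lt// => /(_ isT).
  have [] := dens1 ((a + b) / 2); last by move=> -> ->; rewrite ltxx.
  by apply: (le_lt_trans a0); rewrite midf_lt.
Unshelve. all: by end_near. Qed.

Section truncation.
Context (e : R) (z w : Z).
Hypotheses (e0 : 0 < e) (D_ge0 : forall j, 0 <= D j).
Hypothesis (zwE : orbit_dist sigma h z w =1 fun j => Num.min e (D j)).
Local Notation T := (orbit_dist sigma h z w).

Let T_bnd j : 0 <= T j <= D j.
Proof. by rewrite zwE le_min D_ge0 (ltW e0) ge_min lexx orbT. Qed.

Let Phi_star1 delta : Phi_star rho g x y delta = 1%E ->
  Phi_star sigma h z w delta = 1%E.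
Proof.
move=> E; apply/eqP; rewrite eq_le upper_density_le1 /= -E.
apply: le_upper_density => j /=; apply: le_lt_trans.
by case/andP: (T_bnd j).
Qed.

Let trunc_set delta : delta <= e ->
  [set j | T j < delta] = [set j | D j < delta].
Proof.
move=> de; apply/seteqP; split => j /=; rewrite zwE gt_min;
  last by move=> ->; rewrite orbT.
by case/orP => // /lt_le_trans /(_ de); rewrite ltxx.
Qed.

Let trunc_Phi delta : delta <= e ->
  Phi sigma h z w delta = Phi rho g x y delta.
Proof. by move=> de; rewrite /Phi trunc_set. Qed.

Let trunc_Phi_star delta : delta <= e ->
  Phi_star sigma h z w delta = Phi_star rho g x y delta.
Proof. by move=> de; rewrite /Phi_star trunc_set. Qed.

Let le_Phi d1 d2 : d1 <= d2 -> (Phi rho g x y d1 <= Phi rho g x y d2)%E.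
Proof.
by move=> d12; apply: le_lower_density => j /= /lt_le_trans; exact.
Qed.

(** The constant of the pair is cut down to min(e, eps), below which the
    truncation is invisible.  D3 is excluded: its interval ]a, b[ of distances
    may lie entirely above e. *)
Lemma truncated_chaos_pair P :
  P = LY \/ P = D1 \/ P = D1half \/ P = D2 \/ P = D2half ->
  chaos_pair rho g P x y -> chaos_pair sigma h P z w.
Proof.
move=> [|[|[|[|]]]] -> /=.
- case=> eps eps0 [sup inf]; exists (Num.min e eps); first by rewrite lt_min e0.
  split; last exact: limn_einf_squeeze0 inf.
  apply/limn_esup_geP => r; rewrite lt_min => /andP[re reps] N.
  have [n Nn rn] := (limn_esup_geP _ _).1 sup r reps N.
  by exists n => //; rewrite zwE lt_min re.
- case=> eps eps0 [P0 P1]; exists (Num.min e eps); first by rewrite lt_min e0.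
  split; last by move=> d d0; exact/Phi_star1/P1.
  apply/eqP; rewrite eq_le lower_density_ge0 andbT -P0 trunc_Phi ?le_Phi//;
    by rewrite ge_min lexx ?orbT.
- case=> P0 P1; split; last by move=> d d0; exact/Phi_star1/P1.
  apply: cvg_trans P0; apply: near_eq_cvg; near=> d; apply/esym/trunc_Phi.
  by near: d; exact: nbhs_right_le.
- case=> eps /andP[eps0 eps1] [P0 P1]; exists (Num.min e eps).
    by rewrite lt_min e0 eps0 ge_min eps1 orbT.
  split; last by move=> d d0; exact/Phi_star1/P1.
  rewrite trunc_Phi ?ge_min ?lexx//.
  apply: (@le_trans _ _ (1 - eps)%:E).
    by apply: le_trans P0; rewrite le_Phi// ge_min lexx orbT.
  by rewrite lee_fin lerD2l lerN2 ge_min lexx orbT.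
- case=> eps [c [eps0 c0 H]]; exists (Num.min e eps), c; split => //.
    by rewrite lt_min e0.
  move=> d; rewrite le_min => /andP[d0 /andP[de deps]].
  by rewrite trunc_Phi// trunc_Phi_star//; apply: H; rewrite d0.
Unshelve. all: by end_near. Qed.

(** Without the bound, a few huge D_j could carry the upper mean and be erased
    by truncation; with it, D_j shrinks at most by the factor
    e / max(e, M). *)
Lemma truncated_MLY_pair M : (forall j, (0 < j)%N -> D j <= M) ->
  chaos_pair rho g MLY x y -> chaos_pair sigma h MLY z w.
Proof.
move=> DM [eps eps0 [sup inf]].
pose c := e / Num.max e M.
have m0 : 0 < Num.max e M by rewrite lt_max e0.
have c0 : 0 < c by rewrite divr_gt0.
have cT j : (0 < j)%N -> c * D j <= T j.
  move=> j0; rewrite zwE le_min; apply/andP; split.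
    by rewrite /c mulrAC ler_pdivrMr// ler_pM2l// le_max DM// orbT.
  by rewrite ler_piMl// /c ler_pdivrMr// mul1r le_max lexx.
exists (c * eps); first exact: mulr_gt0.
have nV n : 0 <= (n%:R : R)^-1 by rewrite invr_ge0.
split; last first.
  apply: limn_einf_squeeze0 inf => n; apply/andP; split.
    by rewrite mulr_ge0// sumr_ge0// => j _; case/andP: (T_bnd j).
  by rewrite ler_wpM2r// ler_sum// => j _; case/andP: (T_bnd j).
apply/limn_esup_geP => r re N.
have rc : r / c < eps by rewrite ltr_pdivrMr// mulrC.
have [n Nn rn] := (limn_esup_geP _ _).1 sup _ rc N.
exists n => //; move: rn; rewrite ltr_pdivrMr// => /lt_le_trans; apply.
rewrite /mean_orbit_dist mulrAC ler_wpM2r// mulr_suml.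
rewrite big_nat_cond [leRHS]big_nat_cond ler_sum// => j /andP[/andP[j0 _] _].
by rewrite mulrC cT.
Qed.

End truncation.

End transfer.

(** * Hausdorff distance of nested sets *)

Section hausdorff.
Context (R : realType).

Lemma sup_attained (E : set R) a : E a -> ubound E a -> sup E = a.
Proof.
move=> Ea Eub; apply/eqP; rewrite eq_le ge_sup//=; last by exists a.
by apply: ub_le_sup => //; exists a.
Qed.

Lemma inf_of_ray (E : set R) m :
  lbound E m -> (forall e, m < e -> E e) -> inf E = m.
Proof.
move=> Elb Eray; have Em1 : E (m + 1) by apply: Eray; rewrite ltrDl.
apply/eqP; rewrite eq_le lb_le_inf// ?andbT; last by exists (m + 1).
apply/ler_addgt0Pr => e e0; apply: ge_inf; first by exists m.
by apply: Eray; rewrite ltrDl.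
Qed.

Definition dist_to_set (T : Type) (rho : T -> T -> R) (A : set T) (y : T) : R :=
  inf [set rho y x | x in A].

Section nested.
Context (T : Type) (rho : T -> T -> R).
Hypotheses (rho_ge0 : forall p q, 0 <= rho p q) (rhoxx : forall p, rho p p = 0).
Implicit Types A B : set T.

Lemma hausdorff_distC A B : hausdorff_dist rho A B = hausdorff_dist rho B A.
Proof. exact: maxC. Qed.

Lemma dist_to_set_le A x y : A x -> dist_to_set rho A y <= rho y x.
Proof.
by move=> Ax; apply: ge_inf; [exists 0 => _ [z _ <-]|exists x].
Qed.

Lemma dist_to_set_ge A y m : A !=set0 -> (forall x, A x -> m <= rho y x) ->
  m <= dist_to_set rho A y.
Proof.
move=> [x Ax] mA; apply: lb_le_inf; first by exists (rho y x), x.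
by move=> _ [z Az <-]; exact: mA.
Qed.

Lemma dist_to_set_mem A y : A y -> dist_to_set rho A y = 0.
Proof.
move=> Ay; apply/eqP; rewrite eq_le -{1}(rhoxx y) dist_to_set_le//=.
by apply: dist_to_set_ge => //; exists y.
Qed.

(** Points of A are at distance 0 from B, so one of the two suprema vanishes.
    The other is nonnegative even if it is taken over an unbounded set, since
    its real value is then 0. *)
Lemma hausdorff_dist_nested A B : A !=set0 -> A `<=` B ->
  hausdorff_dist rho A B = sup [set dist_to_set rho A y | y in B].
Proof.
move=> [a Aa] AB; rewrite /hausdorff_dist.
rewrite [X in Num.max X _](_ : _ = 0); last first.
  apply: sup_attained => [|_ [x Ax <-]].
    by exists a => //; exact/dist_to_set_mem/AB.
  by have := dist_to_set_mem (AB _ Ax); rewrite /dist_to_set => ->.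
rewrite (_ : [set inf _ | y in B] = [set dist_to_set rho A y | y in B])//.
apply: max_idPr; set E := [set _ | _ in _].
have [hE|/sup_out ->//] := pselect (has_sup E).
apply: (ub_le_sup hE.2); exists a; first exact: AB.
exact: dist_to_set_mem.
Qed.

Lemma hausdorff_dist_self A : A !=set0 -> hausdorff_dist rho A A = 0.
Proof.
move=> [a Aa]; rewrite hausdorff_dist_nested//; last by exists a.
apply: sup_attained => [|_ [x Ax <-]]; last by rewrite dist_to_set_mem.
by exists a; rewrite ?dist_to_set_mem.
Qed.

End nested.

Section hyper.
Context (X : metricType R).
Local Notation infd := (dist_to_set (@mdist R X)).

Lemma continuous_mdist (a : X) : continuous (mdist a : X -> R).
Proof.
move=> x; apply/cvgrPdist_lt => e e0; near=> y.
have xy : mdist x y < e.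
  by near: y; have := nbhsx_ballx x e e0; rewrite ballEmdist.
have := metric_triangle a x y; have := metric_triangle a y x.
by rewrite (metric_sym y x) ltr_norml => *; apply/andP; split; lra.
Unshelve. all: by end_near. Qed.

Lemma compact_mdist_bounded (A : set X) a : compact A ->
  exists M, forall x, A x -> mdist a x <= M.
Proof.
move=> cA; have : compact (mdist a @` A : set R).
  apply: continuous_compact => //; apply: continuous_subspaceT.
  exact: continuous_mdist.
move=> /compact_bounded [M [_ HM]]; exists (M + 1) => x Ax.
have := HM (M + 1) ltac:(by rewrite ltrDl) _ (imageP _ Ax).
exact: le_trans (ler_norm _).
Qed.

Context (K L : set X) (K0 : K !=set0) (cL : compact L) (KL : K `<=` L).
Local Notation dKL := (hausdorff_dist (@mdist R X) K L).

Lemma hausdorff_mdist_nested : dKL = sup [set infd K x | x in L].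
Proof.
apply: hausdorff_dist_nested => //; [exact: mdist_ge0|exact: mdistxx].
Qed.

Lemma dist_to_set_le_hausdorff x : L x -> infd K x <= dKL.
Proof.
move=> Lx; rewrite hausdorff_mdist_nested; apply: ub_le_sup; last by exists x.
have [a Ka] := K0.
have [M HM] := compact_mdist_bounded a cL.
exists M => _ [y Ly <-]; apply: (le_trans _ (HM y Ly)).
by rewrite metric_sym; apply: dist_to_set_le => //; exact: mdist_ge0.
Qed.

Lemma hausdorff_mdist_le m : (forall x, L x -> infd K x <= m) -> dKL <= m.
Proof.
move=> Lm; rewrite hausdorff_mdist_nested.
apply: ge_sup => [|_ [x Lx <-]]; last exact: Lm.
by have [x /KL Lx] := K0; exists (infd K x), x.
Qed.

Lemma hausdorff_mdist_ge0 : 0 <= dKL.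
Proof.
have [x Kx] := K0.
rewrite -(dist_to_set_mem (@mdist_ge0 _ X) (@mdistxx _ X) Kx).
exact/dist_to_set_le_hausdorff/KL.
Qed.

End hyper.
End hausdorff.

(** * Distances between step functions *)

Section step_functions.
Context (R : realType) (X : metricType R).
Implicit Types (K L : set X) (s t : R).
Local Notation infd := (dist_to_set (@mdist R X)).

Definition step K L s (x : X) : R :=
  if x \in K then 1 else if x \in L then s else 0.

Lemma step_K K L s x : K x -> step K L s x = 1.
Proof. by move=> Kx; rewrite /step mem_set. Qed.

Lemma step_L K L s x : L x -> ~ K x -> step K L s x = s.
Proof. by move=> Lx Kx; rewrite /step memNset// mem_set. Qed.

Lemma step_out K L s x : ~ K x -> ~ L x -> step K L s x = 0.
Proof. by move=> Kx Lx; rewrite /step !memNset. Qed.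

Lemma le_step K L s t x : s <= t -> step K L s x <= step K L t x.
Proof. by rewrite /step; case: ifP => // _; case: ifP. Qed.

Variant step_spec K L s x : R -> Prop :=
| StepK of K x : step_spec K L s x 1
| StepL of L x & ~ K x : step_spec K L s x s
| StepOut of ~ K x & ~ L x : step_spec K L s x 0.

Lemma stepP K L s x : step_spec K L s x (step K L s x).
Proof.
have [Kx|Kx] := pselect (K x); first by rewrite step_K//; constructor.
have [Lx|Lx] := pselect (L x); first by rewrite step_L//; constructor.
by rewrite step_out//; constructor.
Qed.

Section nested.
Context (K L : set X).
Hypotheses (K0 : K !=set0) (cL : compact L) (KL : K `<=` L).
Local Notation dKL := (hausdorff_dist (@mdist R X) K L).
Local Notation u := (step K L).

Lemma step_ge s alpha : 0 < alpha <= s -> s <= 1 ->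
  [set x | alpha <= u s x] = L.
Proof.
move=> /andP[a0 as_] s1; apply/seteqP; split => x /=.
  by case: stepP => // [/KL//|_ _]; rewrite leNgt a0.
by move=> Lx; case: stepP => // _; exact: le_trans s1.
Qed.

Lemma step_ge_above s alpha : 0 <= s < alpha -> alpha <= 1 ->
  [set x | alpha <= u s x] = K.
Proof.
move=> /andP[s0 sa] a1; apply/seteqP; split => x /=; last by move=> /step_K ->.
case: stepP => // [_ _|_ _]; rewrite leNgt ?sa//.
by rewrite (le_lt_trans s0 sa).
Qed.

Lemma step_support s : 0 < s -> fuzzy_support (u s) = L.
Proof.
move=> s0; rewrite /fuzzy_support (_ : [set x | _] = L).
  rewrite -(closure_id _).1//; apply: compact_closed => //.
  exact: metric_hausdorff.
apply/seteqP; split => x /=; first by case: stepP => // [/KL//|]; rewrite ltxx.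
by move=> Lx; case: stepP.
Qed.

Lemma level_step s alpha : 0 < s <= 1 -> 0 <= alpha <= 1 ->
  level (u s) alpha = if alpha <= s then L else K.
Proof.
move=> /andP[s0 s1] /andP[a0 a1]; rewrite /level.
have [->|an0] := eqVneq alpha 0.
  by rewrite step_support// ltW.
have {an0} {}a0 : 0 < alpha by rewrite lt_neqAle eq_sym an0.
case: (leP alpha s) => [as_|sa]; first by rewrite step_ge// a0.
by rewrite step_ge_above// (ltW s0).
Qed.

(** At height max(s, t) the levels are L and K, at all other heights they are
    equal or again L and K; so the supremum is attained. *)
Lemma d_infty_step s t : 0 < s <= 1 -> 0 < t <= 1 ->
  d_infty (u s) (u t) = if s == t then 0 else dKL.
Proof.
wlog st : s t / s <= t.
  move=> H s01 t01; have [st|/ltW ts] := leP s t; first exact: H.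
  rewrite eq_sym -(H t s)// /d_infty; congr sup.
  apply/seteqP; split=> _ [a a01 <-]; exists a => //;
    by rewrite hausdorff_distC.
move=> s01 t01; apply: sup_attained => [|_ [a a01 <-]].
  exists t; first by rewrite /= in_itv/=; case/andP: t01 => /ltW ->.
  rewrite !level_step//; try by case/andP: t01 => /ltW ->.
  rewrite lexx; have [->|nst] := eqVneq s t.
    rewrite lexx hausdorff_dist_self//; [exact: mdist_ge0|exact: mdistxx|].
    by have [x /KL Lx] := K0; exists x.
  by rewrite leNgt lt_neqAle nst st.
move: a01; rewrite /= in_itv/= => a01; rewrite !level_step//.
have D0 : 0 <= (if s == t then 0 else dKL).
  by case: ifP => // _; exact: hausdorff_mdist_ge0.
have self (M : set X) : M !=set0 -> hausdorff_dist (@mdist R X) M M = 0.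
  by apply: hausdorff_dist_self; [exact: mdist_ge0|exact: mdistxx].
have L0 : L !=set0 by have [x /KL Lx] := K0; exists x.
have [as_|sa] := leP a s; first by rewrite (le_trans as_ st) self.
have [at_|ta] := leP a t; last by rewrite self.
by rewrite ifF//; apply/negbTE/eqP => E; rewrite E ltNge at_ in sa.
Qed.

Lemma dbar_ge0 (p q : X * R) : 0 <= dbar p q.
Proof. by rewrite le_max mdist_ge0. Qed.

Lemma dbarxx (p : X * R) : dbar p p = 0.
Proof. by rewrite /dbar mdistxx subrr normr0 maxxx. Qed.

(** The larger graph exceeds the smaller one only above points x of L outside
    K, at heights a in ]s, t].  From (x, a) one reaches the smaller graph
    vertically, at (x, s), or horizontally, above a point of K; any other
    target costs at least as much.  The worst height is t.  The set G is the
    whole space for endographs and L for sendographs. *)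
Lemma hausdorff_endograph_step (G : set X) s t : L `<=` G ->
  0 < s -> s < t -> t <= 1 ->
  hausdorff_dist (@dbar R X) (endograph (u s) `&` (G `*` `[0, 1]))
                    (endograph (u t) `&` (G `*` `[0, 1])) =
  Num.min (t - s) dKL.
Proof.
move=> LG s0 st t1.
set A := endograph (u s) `&` _; set B := endograph (u t) `&` _.
have t0 := lt_trans s0 st.
have s1 : s <= 1 := ltW (lt_le_trans st t1).
have AK y b : K y -> 0 <= b <= 1 -> A (y, b).
  move=> Ky b01; split; [split => //=|split => /=].
  - by rewrite step_K//; case/andP: b01.
  - exact/LG/KL.
  - by rewrite in_itv.
have AL y : L y -> A (y, s).
  move=> Ly; have s01 : 0 <= s <= 1 by rewrite ltW.
  by split; [split => //=; case: stepP|split; [exact: LG|rewrite /= in_itv]].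
have BL y : L y -> B (y, t).
  move=> Ly; have t01 : 0 <= t <= 1 by rewrite ltW.
  by split; [split => //=; case: stepP|split; [exact: LG|rewrite /= in_itv]].
have AB : A `<=` B.
  move=> [y b] [[/= b01 bu] GI]; split => //; split => //=.
  by apply: le_trans bu _; exact/le_step/ltW.
have [x0 Kx0] := K0.
have A0 : A !=set0 by exists (x0, 0); apply: AK; rewrite ?lexx ?ler01.
rewrite hausdorff_dist_nested//; [|exact: dbar_ge0|exact: dbarxx].
have ub :
    ubound [set dist_to_set (@dbar R X) A q | q in B] (Num.min (t - s) dKL).
  move=> _ [[x a] [[/= a01 au] GI] <-].
  (* Outside A, the point x lies in L but not in K, and s < a <= t. *)
  have [Aq|nAq] := pselect (A (x, a)).
    rewrite (dist_to_set_mem dbar_ge0 dbarxx Aq) le_min.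
    rewrite hausdorff_mdist_ge0// andbT.
    by rewrite subr_ge0 ltW.
  have sau : step K L s x < a.
    by rewrite ltNge; apply/negP => ?; exact: nAq.
  have [Lx nKx] : L x /\ ~ K x.
    move: au sau; case: stepP => //.
    - by move=> Kx _; rewrite step_K// ltNge; case/andP: a01 => _ ->.
    - by move=> nK nL a0; rewrite step_out// ltNge a0.
  move: au sau; rewrite !step_L// => at_ sa.
  rewrite le_min; apply/andP; split.
    apply: le_trans (dist_to_set_le dbar_ge0 _ (AL x Lx)) _.
    rewrite /dbar /= mdistxx ge_max subr_ge0 (ltW st) /=.
    rewrite ger0_norm ?subr_ge0 ?(ltW sa)//.
    by rewrite lerD2r.
  apply: le_trans (dist_to_set_le_hausdorff K0 cL KL Lx).
  apply: dist_to_set_ge; first by exists x0.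
  move=> y Ky; apply: le_trans (dist_to_set_le dbar_ge0 _ (AK y a Ky a01)) _.
  by rewrite /dbar/= subrr normr0 ge_max lexx mdist_ge0.
apply/eqP; rewrite eq_le; apply/andP; split.
  apply: ge_sup => //.
  exists (dist_to_set (@dbar R X) A (x0, t)), (x0, t) => //.
  exact/BL/KL.
set S := sup _.
(* At the top point (x, t) neither way to A costs less than this. *)
have lb x : L x -> Num.min (t - s) (infd K x) <= S.
  move=> Lx.
  apply: (@le_trans _ _ (dist_to_set (@dbar R X) A (x, t))); last first.
    apply: ub_le_sup; first by exists (Num.min (t - s) dKL).
    by exists (x, t) => //; exact: BL.
  apply: dist_to_set_ge => // -[y b] [[/= /andP[b0 b1] bu] _].
  rewrite /dbar/=; have [Ky|nKy] := pselect (K y).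
    rewrite ge_min; apply/orP; right; rewrite le_max; apply/orP; left.
    by apply: dist_to_set_le => //; exact: mdist_ge0.
  have bs : b <= s.
    by move: bu; case: stepP => // _ _ /le_trans; apply; exact: ltW.
  rewrite ge_min; apply/orP; left; rewrite le_max; apply/orP; right.
  rewrite ger0_norm ?subr_ge0 ?(le_trans bs (ltW st))//.
  by rewrite lerD2l lerN2.
rewrite ge_min; have [//|/= Sts] := leP (t - s) S.
by apply: hausdorff_mdist_le => // x /lb; rewrite ge_min leNgt Sts.
Qed.

Lemma d_end_step s t : 0 < s < 1 -> 0 < t < 1 -> s != t ->
  d_end (u s) (u t) = Num.min `|s - t| dKL.
Proof.
wlog st : s t / s < t.
  move=> H s01 t01; rewrite neq_lt => /orP[]st.
    by apply: H => //; rewrite lt_eqF.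
  by rewrite /d_end hausdorff_distC distrC; apply: H => //; rewrite lt_eqF.
move=> /andP[s0 s1] /andP[t0 t1] _; rewrite distrC gtr0_norm ?subr_gt0//.
rewrite /d_end -(@hausdorff_endograph_step setT)//; last exact: ltW.
suff E v : endograph v = endograph v `&` ([set: X] `*` `[0, 1]) by rewrite -!E.
apply/seteqP; split=> [p vp|p []//]; split => //; split => //=.
by rewrite in_itv/=; case: vp.
Qed.

Lemma d_send_step s t : 0 < s < 1 -> 0 < t < 1 -> s != t ->
  d_send (u s) (u t) = Num.min `|s - t| dKL.
Proof.
wlog st : s t / s < t.
  move=> H s01 t01; rewrite neq_lt => /orP[]st.
    by apply: H => //; rewrite lt_eqF.
  by rewrite /d_send hausdorff_distC distrC; apply: H => //; rewrite lt_eqF.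
move=> /andP[s0 s1] /andP[t0 t1] _; rewrite distrC gtr0_norm ?subr_gt0//.
by rewrite /d_send /sendograph !step_support// hausdorff_endograph_step// ltW.
Qed.

End nested.
End step_functions.

(** * Skorokhod distance of step functions *)

Section knee.
Context (R : realType).
Implicit Types (s t a : R).

(** The piecewise affine homeomorphism of [0, 1] that fixes 0 and 1 and maps t
    to s; the absolute value glues the slopes s / t and (1 - s) / (1 - t) into
    one expression, which is visibly continuous. *)
Definition knee s t a : R :=
  s + (s / t + (1 - s) / (1 - t)) / 2 * (a - t)
    + ((1 - s) / (1 - t) - s / t) / 2 * `|a - t|.

Lemma knee_below s t a : a <= t -> knee s t a = s + s / t * (a - t).
Proof. by move=> at_; rewrite /knee ler0_norm ?subr_le0//; lra. Qed.

Lemma knee_above s t a : t <= a -> knee s t a = s + (1 - s) / (1 - t) * (a - t).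
Proof. by move=> ta; rewrite /knee ger0_norm ?subr_ge0//; lra. Qed.

Lemma knee_fix s t : knee s t t = s.
Proof. by rewrite knee_below// subrr mulr0 addr0. Qed.

Lemma knee_continuous s t : continuous (knee s t).
Proof.
move=> a; apply: cvgD; [apply: cvgD; first exact: cvg_cst|];
  (apply: cvgM; first exact: cvg_cst).
  by apply: cvgB; [exact: cvg_id|exact: cvg_cst].
by apply: cvg_norm; apply: cvgB; [exact: cvg_id|exact: cvg_cst].
Qed.

Section bounds.
Context (s t : R).
Hypotheses (s01 : 0 < s < 1) (t01 : 0 < t < 1).

Let slope1 : 0 < s / t.
Proof. by case/andP: s01 t01 => s0 _ /andP[t0 _]; rewrite divr_gt0. Qed.

Let slope2 : 0 < (1 - s) / (1 - t).
Proof.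
by case/andP: s01 t01 => _ s1 /andP[_ t1]; rewrite divr_gt0 ?subr_gt0.
Qed.

Lemma knee_mono : {homo knee s t : a b / a < b}.
Proof.
move=> a b ab; have [at_|ta] := leP a t; have [bt|tb] := leP b t.
- by rewrite !knee_below// ltrD2l ltr_pM2l// ltrD2r.
- rewrite knee_below// knee_above ?(ltW tb)// ltrD2l.
  apply: (@le_lt_trans _ _ 0); last by rewrite mulr_gt0// subr_gt0.
  by rewrite mulr_ge0_le0 ?(ltW slope1)// subr_le0.
- by move: (lt_trans ta ab); rewrite ltNge bt.
- by rewrite !knee_above ?ltW// ltrD2l ltr_pM2l// ltrD2r.
Qed.

Lemma knee0 : knee s t 0 = 0.
Proof.
case/andP: t01 => t0 t1; rewrite knee_below ?ltW//.
by field; rewrite gt_eqF.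
Qed.

Lemma knee1 : knee s t 1 = 1.
Proof.
case/andP: t01 => t0 t1; rewrite knee_above ?ltW//.
by field; rewrite gt_eqF// subr_gt0.
Qed.

Lemma knee_itv a : 0 <= a <= 1 -> 0 <= knee s t a <= 1.
Proof.
move=> /andP[a0 a1]; rewrite -{1}knee0 -{1}knee1.
by rewrite !(ltW_homo knee_mono).
Qed.

(** knee s t - id is affine on both sides of t, vanishes at 0 and 1 and equals
    s - t at t. *)
Lemma knee_dist a : 0 <= a <= 1 -> `|knee s t a - a| <= `|s - t|.
Proof.
move=> /andP[a0 a1]; case/andP: t01 => t0 t1; have [at_|/ltW ta] := leP a t.
  have -> : knee s t a - a = (s - t) * (a / t).
    by rewrite knee_below//; field; rewrite gt_eqF.
  rewrite normrM ler_piMr// ger0_norm ?divr_ge0 ?(ltW t0)//.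
  by rewrite ler_pdivrMr// mul1r.
have -> : knee s t a - a = (s - t) * ((1 - a) / (1 - t)).
  by rewrite knee_above//; field; rewrite gt_eqF ?subr_gt0.
rewrite normrM ler_piMr// ger0_norm ?divr_ge0 ?subr_ge0 ?(ltW t1)//.
by rewrite ler_pdivrMr ?subr_gt0// mul1r lerD2l lerN2.
Qed.

End bounds.

Lemma kneeK s t : 0 < s < 1 -> 0 < t < 1 -> cancel (knee s t) (knee t s).
Proof.
move=> s01 t01 a; case/andP: (s01) (t01) => s0 s1 /andP[t0 t1].
have ks := ltW_homo (knee_mono s01 t01).
have [at_|/ltW ta] := leP a t.
  rewrite [LHS]knee_below; last by rewrite -[leRHS](knee_fix s t) ks.
  by rewrite knee_below//; field; rewrite !gt_eqF.
rewrite [LHS]knee_above; last by rewrite -[leLHS](knee_fix s t) ks.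
by rewrite knee_above//; field; rewrite !gt_eqF ?subr_gt0.
Qed.

Lemma increasing_homeo_knee s t : 0 < s < 1 -> 0 < t < 1 ->
  increasing_homeo (knee s t).
Proof.
move=> s01 t01; split; first by move=> a b _ _; exact: knee_mono.
exists (knee t s); split.
- by split=> a /=; rewrite !in_itv /=; exact: knee_itv.
- by split=> a _; exact: kneeK.
- by apply: continuous_subspaceT; exact: knee_continuous.
- by apply: continuous_subspaceT; exact: knee_continuous.
Qed.

(** Since 0 and 1 are fixed, composing a step function with xi gives a step
    function of the same kind. *)
Lemma increasing_homeo_endpoints (xi : R -> R) t : increasing_homeo xi ->
  [/\ xi 0 = 0, xi 1 = 1 & 0 < t < 1 -> 0 < xi t < 1].
Proof.
move=> [mono [zeta [[fxi fzeta] [xiK zetaK] _ _]]].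
have in0 : (0 : R) \in `[0, 1] by rewrite in_itv/= lexx ler01.
have in1 : (1 : R) \in `[0, 1] by rewrite in_itv/= lexx ler01.
have fx a : a \in `[0, 1] -> 0 <= xi a <= 1.
  by move=> a01; have := fxi _ a01; rewrite /= in_itv.
have fz a : a \in `[0, 1] -> zeta a \in `[0, 1].
  by move=> a01; exact: fzeta _ a01.
have xi0 : xi 0 = 0.
  have := fz _ in0; rewrite in_itv/= => /andP[].
  rewrite le_eqVlt => /orP[/eqP z0 _|z0 _].
    by rewrite [in LHS]z0 zetaK.
  have := mono _ _ in0 (fz _ in0) z0; rewrite zetaK// => /lt_geF.
  by case/andP: (fx _ in0) => ->.
have xi1 : xi 1 = 1.
  have := fz _ in1; rewrite in_itv/= => /andP[_].
  rewrite le_eqVlt => /orP[/eqP z1|z1].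
    by rewrite -[in LHS]z1 zetaK.
  have := mono _ _ (fz _ in1) in1 z1; rewrite zetaK// => /lt_geF.
  by case/andP: (fx _ in1) => _ ->.
split => // /andP[t0 t1]; have tin : t \in `[0, 1] by rewrite in_itv/= !ltW.
by rewrite -{1}xi0 -{1}xi1 !mono.
Qed.

End knee.

Section skorokhod.
Context (R : realType) (X : metricType R) (K L : set X).
Hypotheses (K0 : K !=set0) (cL : compact L) (KL : K `<=` L).
Local Notation u := (step K L).
Local Notation dKL := (hausdorff_dist (@mdist R X) K L).

(** A reparametrization xi turns [step K L t] into [step K L (xi t)].  If
    xi t = s the fuzzy sets agree and the cost is that of xi, at least
    |s - t|, with equality for [knee s t]; otherwise the d_infty term is the
    full Hausdorff distance, and the identity, [knee t t], is optimal. *)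
Lemma d_zero_step s t : 0 < s < 1 -> 0 < t < 1 -> s != t ->
  d_zero (u s) (u t) = Num.min `|s - t| dKL.
Proof.
move=> s01 t01 st.
have closed01 (r : R) : 0 < r < 1 -> 0 < r <= 1 by move=> /andP[-> /ltW].
have comp xi : increasing_homeo xi -> xi \o u t = u (xi t).
  move=> /(increasing_homeo_endpoints t)[xi0 xi1 _]; apply/funext => x /=.
  by rewrite /step; case: ifP => // _; case: ifP.
have st0 : 0 < `|s - t| by rewrite normr_gt0 subr_eq0.
have tin : t \in `[0, 1] by rewrite in_itv/=; case/andP: t01 => /ltW -> /ltW.
apply: inf_of_ray => [e [e0 [xi [hxi xie]]]|e].
  rewrite comp//; have [_ _ /(_ t01) xit] := increasing_homeo_endpoints t hxi.
  rewrite d_infty_step// ?closed01//; case: eqP => [E _|_ De]; last first.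
    by rewrite ge_min De orbT.
  rewrite ge_min; apply/orP; left; apply: le_trans xie; rewrite {1}E.
  apply: ub_le_sup; last by exists t.
  exists 1 => _ [a a01 <-].
  case: (hxi) => _ [_ [[fxi _] _ _ _]].
  have /= := fxi _ a01; move: a01.
  rewrite /= !in_itv/= => /andP[a0 a1] /andP[x0 x1].
  by rewrite ler_norml; apply/andP; split; lra.
rewrite gt_min => /orP[ste|De].
- split; first exact: lt_trans ste.
  exists (knee s t); split; first exact: increasing_homeo_knee.
    apply: (@le_trans _ _ `|s - t|); last exact: ltW.
    apply: ge_sup; first by exists `|knee s t t - t|, t.
    by move=> _ [a /= a01 <-]; apply: knee_dist => //; rewrite in_itv in a01.
  rewrite comp ?knee_fix; last exact: increasing_homeo_knee.
  by rewrite d_infty_step ?closed01// eqxx (ltW (lt_trans st0 ste)).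
- have e0 : 0 < e by apply: le_lt_trans De; exact: hausdorff_mdist_ge0.
  split => //; exists (knee t t); split; first exact: increasing_homeo_knee.
    apply: (@le_trans _ _ 0); last exact: ltW.
    apply: ge_sup; first by exists `|knee t t t - t|, t.
    move=> _ [a /= a01 <-]; rewrite -(normr0 R) -(subrr t).
    by apply: knee_dist => //; rewrite in_itv in a01.
  rewrite comp ?knee_fix; last exact: increasing_homeo_knee.
  by rewrite d_infty_step ?closed01// (negPf st) ltW.
Qed.

End skorokhod.

(** * The uncountable family of fuzzy sets *)

Section fuzzy_family.
Context (R : realType) (X : metricType R).
Implicit Types (K L : hyperspace X) (s t : R).

Lemma step_itv (K L : set X) s x : 0 < s < 1 -> 0 <= step K L s x <= 1.
Proof.
by move=> /andP[/ltW s0 /ltW s1]; case: stepP => *; rewrite ?lexx ?ler01 ?s0.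
Qed.

Lemma step_usc (K L : set X) s :
  closed K -> closed L -> K `<=` L -> 0 < s < 1 ->
  upper_semicontinuous (step K L s).
Proof.
move=> cK cL KL s01 x a; case/andP: (s01) => s0 s1.
case: stepP => [Kx|Lx nKx|nKx nLx] xa.
- near=> y; apply: le_lt_trans xa.
  by case/andP: (step_itv K L y s01).
- have nK : \forall y \near x, ~ K y.
    by apply: (open_nbhs_nbhs (conj (closed_openC cK) nKx)).
  near=> y; have nKy : ~ K y by near: y.
  by apply: le_lt_trans xa; case: stepP => // *; exact: ltW.
- have nL : \forall y \near x, ~ L y.
    by apply: (open_nbhs_nbhs (conj (closed_openC cL) nLx)).
  near=> y; have nLy : ~ L y by near: y.
  by rewrite step_out// => /KL.
Unshelve. all: by end_near. Qed.

Lemma hyper_closed K : closed (K : set X).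
Proof.
by apply: compact_closed; [exact: metric_hausdorff|exact: hyper_compact].
Qed.

Section step_fuzzy.
Context (K L : hyperspace X) (KL : (K : set X) `<=` L).
Context (s : R) (s01 : 0 < s < 1).

Let step_compact : compact (level (step K L s) 0).
Proof.
rewrite /level eqxx step_support//; first exact: hyper_compact.
- exact: hyper_compact.
- by case/andP: s01.
Qed.

Let step_normal : level (step K L s) 1 !=set0.
Proof.
by have [x Kx] := hyper_nonempty K; exists x; rewrite /level oner_eq0/= step_K.
Qed.

Definition step_fuzzy : fuzzy X :=
  Fuzzy (fun x => step_itv K L x s01)
    (step_usc (@hyper_closed K) (@hyper_closed L) KL s01)
    step_compact step_normal.

End step_fuzzy.

Lemma zadeh_fun_step (f : X -> X) (K L : set X) s : K `<=` L -> 0 < s < 1 ->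
  zadeh_fun f (step K L s) = step (f @` K) (f @` L) s.
Proof.
move=> KL s01; case/andP: (s01) => s0 s1; apply/funext => x.
rewrite /zadeh_fun; case: asboolP => [[y0 fy0]|nx]; last first.
  by rewrite step_out// => -[y _ fyx]; apply: nx; exists y.
case: stepP => [[y Ky <-]|[y Ly <-] nK|nK nL]; apply: sup_attained.
- by exists y => //; rewrite step_K.
- by move=> _ [z _ <-]; case/andP: (step_itv K L z s01).
- by exists y => //; rewrite step_L// => Ky; apply: nK; exists y.
- move=> _ [z /= fz <-]; case: stepP => // [Kz|*]; last exact: ltW.
  by exfalso; apply: nK; exists z.
- exists y0 => //; rewrite step_out// => Ay; [apply: nK|apply: nL];
    by exists y0.
- move=> _ [z /= fz <-]; rewrite step_out// => Az; [apply: nK|apply: nL];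
    by exists z.
Qed.

Context (f : X -> X) (cf : continuous f).

Lemma iter_hyper_map_sub K L j : (K : set X) `<=` L ->
  (iter j (hyper_map cf) K : set X) `<=` iter j (hyper_map cf) L.
Proof. by move=> KL; elim: j => //= j IH; exact: image_subset. Qed.

Lemma iter_zadeh_step K L (KL : (K : set X) `<=` L) s (s01 : 0 < s < 1) j :
  fuzzy_fun (iter j (zadeh cf) (step_fuzzy KL s01)) =
  step (iter j (hyper_map cf) K) (iter j (hyper_map cf) L) s.
Proof.
elim: j => //= j ->; rewrite zadeh_fun_step//; exact: iter_hyper_map_sub.
Qed.

Definition step_family K L (KL : (K : set X) `<=` L) : set (fuzzy X) :=
  [set u | exists s (s01 : 0 < s < 1), u = step_fuzzy KL s01].

(** Evaluation at a point of L outside K recovers s and so maps the family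
    onto ]0, 1[. *)
Lemma step_family_uncountable K L (KL : (K : set X) `<=` L) :
  (K : set X) <> L -> ~ countable (step_family KL).
Proof.
move=> KnL cF; have [x [Lx nKx]] : exists x, (L : set X) x /\ ~ (K : set X) x.
  apply: contrapT => H; apply: KnL; apply/seteqP; split => // x Lx.
  by apply: contrapT => nK; apply: H; exists x.
have : countable (`]0, 1[ : set R).
  apply: (@sub_countable _ _ _ ((fun u : fuzzy X => u x) @` step_family KL)).
    apply: subset_card_le => s /=; rewrite in_itv/= => s01.
    by exists (step_fuzzy KL s01); [exists s, s01|rewrite /= step_L].
  exact: sub_countable (card_image_le _ _) cF.
move=> /countable_lebesgue_measure0; rewrite lebesgue_measure_itv /=.
by rewrite lte_fin ltr01 sube0 => /eqP; rewrite eqe oner_eq0.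
Qed.

(** The formula d gives the distance of two step functions from their
    parameters and the Hausdorff distance of the underlying sets; it is the
    same at every time because iteration keeps the parameters. *)
Lemma step_family_orbits (rho : (X -> R) -> (X -> R) -> R)
    (d : R -> R -> R -> R) K L (KL : (K : set X) `<=` L) :
  (forall s t, 0 < s < 1 -> 0 < t < 1 -> s != t -> forall A B : hyperspace X,
     (A : set X) `<=` B ->
     rho (step A B s) (step A B t) = d s t (dH A B)) ->
  forall u v, step_family KL u -> step_family KL v -> u <> v ->
  exists s t, [/\ 0 < s < 1, 0 < t < 1, s != t &
    orbit_dist (fun u v : fuzzy X => rho u v) (zadeh cf) u v =1
    fun j => d s t (orbit_dist (@dH R X) (hyper_map cf) K L j)].
Proof.
move=> rhoE u v [s [s01 ->]] [t [t01 ->]] uv; exists s, t.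
have st : s != t.
  by apply/eqP => E; subst t; apply: uv; rewrite (bool_irrelevance s01 t01).
split => // j; rewrite /orbit_dist !iter_zadeh_step rhoE//.
exact: iter_hyper_map_sub.
Qed.

End fuzzy_family.

(** * Chaos for the hyperspace map and the Zadeh extension *)

Section main.
Context (R : realType) (X : metricType R) (f : X -> X) (cf : continuous f).
Local Notation hf := (hyper_map cf).

Lemma hyper_chaos_pair_neq P (K L : hyperspace X) :
  chaos_pair (@dH R X) hf P K L -> (K : set X) <> L.
Proof.
move=> KLP KL; apply: orbit_dist0_not_chaos_pair KLP => j.
have E : hyper_set (iter j hf L) = hyper_set (iter j hf K).
  by elim: j => //= j ->.
rewrite /orbit_dist /dH E; apply: hausdorff_dist_self => //.
- exact: mdist_ge0.
- exact: mdistxx.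
- exact: hyper_nonempty.
Qed.

Lemma pair_in_hyperspace (x y : X) : exists K L : hyperspace X,
  (K : set X) `<=` L /\
  forall j, dH (iter j hf K) (iter j hf L) = mdist (iter j f x) (iter j f y).
Proof.
have K0 : [set x] !=set0 by exists x.
have L0 : [set x; y] !=set0 by exists x; left.
have cK : compact [set x] by exact: compact_set1.
have cL : compact [set x; y] by apply: compactU; exact: compact_set1.
exists (Hyperspace K0 cK), (Hyperspace L0 cL); split.
  by move=> _ ->; left.
move=> j; rewrite /dH.
have -> : hyper_set (iter j hf (Hyperspace K0 cK)) = [set iter j f x].
  by elim: j => //= j ->; rewrite image_set1.
have -> : hyper_set (iter j hf (Hyperspace L0 cL)) =
    [set iter j f x; iter j f y].
  by elim: j => //= j ->; rewrite image_setU !image_set1.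
move: (iter j f x) (iter j f y) => {K0 L0 cK cL}x {}y.
have dE z : dist_to_set (@mdist R X) [set x] z = mdist z x.
  by rewrite /dist_to_set image_set1 inf1.
rewrite hausdorff_mdist_nested; [|by exists x|by move=> _ ->; left].
apply: sup_attained => [|_ [z + <-]].
  by exists y; [right|rewrite dE metric_sym].
by rewrite dE => -[] ->; rewrite ?mdistxx ?mdist_ge0// metric_sym.
Qed.


Lemma U_chaotic_d_infty P (K L : hyperspace X) :
  chaos_pair (@dH R X) hf P K L -> (K : set X) `<=` L ->
  U_chaotic (@dF_infty R X) (zadeh cf) P.
Proof.
move=> KLP KL; apply: U_chaotic_of_equal_orbits (KLP).
  exact: (step_family_uncountable (KL := KL) (hyper_chaos_pair_neq KLP)).
move=> u v Su Sv uv.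
have [|s [t [_ _ _ E]] //] := @step_family_orbits _ _ _ cf (@d_infty R X)
  (fun _ _ D => D) K L KL _ u v Su Sv uv.
move=> s t /andP[s0 /ltW s1] /andP[t0 /ltW t1] st A B AB.
rewrite d_infty_step ?s0 ?t0 ?(negPf st)//; [|exact: hyper_compact].
exact: hyper_nonempty.
Qed.

Lemma chaotic_of_truncated_metric (rho : (X -> R) -> (X -> R) -> R) P :
  (forall (K L : set X), K !=set0 -> compact L -> K `<=` L ->
     forall s t, 0 < s < 1 -> 0 < t < 1 -> s != t ->
     rho (step K L s) (step K L t) =
     Num.min `|s - t| (hausdorff_dist (@mdist R X) K L)) ->
  forall K L : hyperspace X,
  P = LY \/ P = D1 \/ P = D1half \/ P = D2 \/ P = D2half \/
    P = MLY /\ bounded_set [set dH (iter j hf K) (iter j hf L)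
                           | j in [set j : nat | (1 <= j)%N]] ->
  chaos_pair (@dH R X) hf P K L -> (K : set X) `<=` L ->
  chaotic (fun u v : fuzzy X => rho u v) (zadeh cf) P.
Proof.
move=> rhoE K L PE KLP KL; exists (step_family KL).
  exact: step_family_uncountable (hyper_chaos_pair_neq KLP).
move=> u v Su Sv uv.
have [|s [t [_ _ st E]]] := @step_family_orbits _ _ _ cf rho
  (fun s t D => Num.min `|s - t| D) K L KL _ u v Su Sv uv.
  move=> s t s01 t01 st A B AB; rewrite rhoE//; [exact: hyper_nonempty|].
  exact: hyper_compact.
have st0 : 0 < `|s - t| by rewrite normr_gt0 subr_eq0.
have D0 j : 0 <= orbit_dist (@dH R X) hf K L j.
  apply: hausdorff_mdist_ge0; [exact: hyper_nonempty|exact: hyper_compact|].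
  exact: iter_hyper_map_sub.
case: PE KLP => [->|[->|[->|[->|[->|[-> [M [_ HM]]]]]]]] KLP;
  try by apply: truncated_chaos_pair st0 D0 E _ _ KLP; tauto.
apply: (truncated_MLY_pair st0 D0 E (M := M + 1)) KLP => j j0.
apply: le_trans (ler_norm _) (HM (M + 1) _ _ _); first by rewrite ltrDl.
by exists j.
Qed.

End main.

Theorem theorem3p3 (R : realType) (X : metricType R) (f : X -> X)
    (cf : continuous f) :
  (forall (P : chaos_kind) (x y : X), chaos_pair (@mdist R X) f P x y ->
     exists K L : hyperspace X,
       [/\ chaos_pair (@dH R X) (hyper_map cf) P K L,
           (K : set X) `<=` L &
           forall j : nat,
             dH (iter j (hyper_map cf) K) (iter j (hyper_map cf) L) =
             mdist (iter j f x) (iter j f y)]) /\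
  (forall P : chaos_kind,
     (exists K L : hyperspace X,
        chaos_pair (@dH R X) (hyper_map cf) P K L /\ (K : set X) `<=` L) ->
     U_chaotic (@dF_infty R X) (zadeh cf) P) /\
  (forall P : chaos_kind,
     P = LY \/ P = D1 \/ P = D1half \/ P = D2 \/ P = D2half ->
     (exists K L : hyperspace X,
        chaos_pair (@dH R X) (hyper_map cf) P K L /\ (K : set X) `<=` L) ->
     [/\ chaotic (@dF_zero R X) (zadeh cf) P,
         chaotic (@dF_send R X) (zadeh cf) P &
         chaotic (@dF_end R X) (zadeh cf) P]) /\
  ((exists K L : hyperspace X,
      [/\ chaos_pair (@dH R X) (hyper_map cf) MLY K L,
          (K : set X) `<=` L &
          bounded_set [set dH (iter j (hyper_map cf) K)
                              (iter j (hyper_map cf) L)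
                      | j in [set j : nat | (1 <= j)%N]]]) ->
   [/\ chaotic (@dF_zero R X) (zadeh cf) MLY,
       chaotic (@dF_send R X) (zadeh cf) MLY &
       chaotic (@dF_end R X) (zadeh cf) MLY]).
Proof.
split=> [P x y xyP|].
  have [K [L [KL D]]] := pair_in_hyperspace cf x y.
  by exists K, L; split => //; apply: eq_orbit_chaos_pair xyP.
split=> [P [K [L [KLP KL]]]|]; first exact: U_chaotic_d_infty KLP KL.
split=> [P PE [K [L [KLP KL]]]|[K [L [KLP KL bD]]]].
  by split; [apply: chaotic_of_truncated_metric (@d_zero_step R X) _ _ _ KLP KL
            |apply: chaotic_of_truncated_metric (@d_send_step R X) _ _ _ KLP KL
            |apply: chaotic_of_truncated_metric (@d_end_step R X) _ _ _ KLP KL];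
    tauto.
by split; [apply: chaotic_of_truncated_metric (@d_zero_step R X) _ _ _ KLP KL
          |apply: chaotic_of_truncated_metric (@d_send_step R X) _ _ _ KLP KL
          |apply: chaotic_of_truncated_metric (@d_end_step R X) _ _ _ KLP KL];
    tauto.
Qed.
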